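(* Let $\mathbb{V}=U\oplus W$ be a finite-dimensional vector space over a field $\mathcal{F}$, where $U$ and $W$ are nonzero subspaces and $\dim(\mathbb{V})>1$. If $D=\{x_1,x_2,\dots,x_k\}$ is a minimal dominating set of the direct sum graph $\Gamma_{U\oplus W}(\mathbb{V})$, then $k\leq \dim(U)\dim(W)$.
   Context: Let $\mathbb{V}$ be a vector space over a field $\mathcal{F}$ with $\mathbb{V}=U\oplus W$, where $U,W$ are nonzero subspaces, $\dim U=r$, $\dim W=s$, $r+s=n=\dim\mathbb{V}$. Fix a basis $\{\alpha_1,\dots,\alpha_r\}$ of $U$ and a basis $\{\beta_1,\dots,\beta_s\}$ of $W$; every $x\in\mathbb{V}$ is written uniquely as $x=a_1\alpha_1+\dots+a_r\alpha_r+b_1\beta_1+\dots+b_s\beta_s$. The direct sum graph $\Gamma_{U\oplus W}(\mathbb{V})$ is the simple graph whose vertex set is $\{x=u+w: u\in U, w\in W, u\neq 0, w\neq 0\}$, in which two distinct vertices $x,y$ are adjacent iff there is an index $i$ such that the coefficient of $\alpha_i$ is nonzero in both $x$ and $y$, and there is an index $j$ such that the coefficient of $\beta_j$ is nonzero in both $x$ and $y$. A set $D$ of vertices is dominating if every vertex not in $D$ is adjacent to some vertex of $D$; it is a minimal dominating set if it is dominating and no proper subset of it is dominating. *)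

(* Defs.v *)
From HB Require Import structures.
From mathcomp Require Import all_boot all_order all_algebra.
From mathcomp Require Import boolp classical_sets.

Set Implicit Arguments.
Unset Strict Implicit.
Unset Printing Implicit Defensive.

Import GRing.Theory.
Local Open Scope ring_scope.
Local Open Scope classical_set_scope.

(* The carrier need not be finite: the direct sum graph is infinite over an
   infinite field. *)
Record simple_graph (T : Type) := SimpleGraph {
  vertex : set T;
  adjacent : T -> T -> Prop;
  adjacent_vertex : forall x y, adjacent x y -> vertex x /\ vertex y;
  adjacent_sym : forall x y, adjacent x y -> adjacent y x;
  adjacent_irrefl : forall x, ~ adjacent x x }.

Definition dominating (T : Type) (G : simple_graph T) (D : set T) : Prop :=
  D `<=` vertex G /\
  forall x, vertex G x -> ~ D x -> exists2 y, D y & adjacent G x y.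

Definition minimal_dominating (T : Type) (G : simple_graph T) (D : set T)
    : Prop :=
  dominating G D /\ forall E : set T, E `<` D -> ~ dominating G E.

Section DirectSumGraph.

Variables (F : fieldType) (V : vectType F) (U W : {vspace V}).
Variables (r s : nat) (alpha : r.-tuple V) (beta : s.-tuple V).

Definition coefU (i : 'I_r) (x : V) : F :=
  coord (cat_tuple alpha beta) (lshift s i) x.

Definition coefW (j : 'I_s) (x : V) : F :=
  coord (cat_tuple alpha beta) (rshift r j) x.

Definition dsg_vertex : set V :=
  [set x | exists u w,
     [/\ u \in U, w \in W, u != 0, w != 0 & x = u + w]].

Definition dsg_adjacent (x y : V) : Prop :=
  [/\ dsg_vertex x, dsg_vertex y, x <> y,
      exists i, coefU i x != 0 /\ coefU i y != 0 &
      exists j, coefW j x != 0 /\ coefW j y != 0].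

Lemma dsg_adjacent_vertex x y :
  dsg_adjacent x y -> dsg_vertex x /\ dsg_vertex y.
Proof. by case. Qed.

Lemma dsg_adjacent_sym x y : dsg_adjacent x y -> dsg_adjacent y x.
Proof.
by case=> vx vy xy [i [ix iy]] [j [jx jy]]; split=> //;
  [move/esym | exists i | exists j].
Qed.

Lemma dsg_adjacent_irrefl x : ~ dsg_adjacent x x.
Proof. by case. Qed.

Definition direct_sum_graph : simple_graph V :=
  SimpleGraph dsg_adjacent_vertex dsg_adjacent_sym dsg_adjacent_irrefl.

End DirectSumGraph.

(* Main.v *)
(* A vertex is determined, as far as adjacency goes, by the rectangle of pairs
   (i, j) such that its alpha_i and beta_j coefficients are both nonzero: two
   distinct vertices are adjacent iff their rectangles meet.  By minimality,
   every x in D has a private closed neighbour v, i.e. one equal or adjacent to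
   x but to no other element of D.  A pair common to the rectangles of x and v
   lies in the rectangle of no other element of D, so choosing such a pair for
   each x embeds D into the dim U * dim W pairs. *)
Require Import Defs.
From HB Require Import structures.
From mathcomp Require Import all_boot all_order all_algebra.
From mathcomp Require Import boolp classical_sets.

Set Implicit Arguments.
Unset Strict Implicit.
Unset Printing Implicit Defensive.

Import GRing.Theory.
Local Open Scope ring_scope.
Local Open Scope classical_set_scope.

Section MinimalDominating.

Variables (T : Type) (G : simple_graph T) (D : set T).
Hypothesis minD : minimal_dominating G D.

(** By minimality [D] without [x] leaves some vertex [v] undominated. If [v] is in [D], it must be
    [x]; otherwise its neighbour in [D] can only be [x]. *)
Lemma minimal_dominating_private (x : T) : D x ->
  exists v, [/\ vertex G v, v = x \/ adjacent G v x &
    forall y, D y -> y <> x -> v <> y /\ ~ adjacent G v y].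
Proof.
move=> Dx; have [[DG domD] /(_ (D `\ x))] := minD.
have ltDx : D `\ x `<` D.
  by split=> [y []//|/(_ x Dx)[_]]; apply.
move=> /(_ ltDx) ndom; apply: contrapT => noprivate; apply: ndom.
split=> [y [/DG]//|v Gv nDv]; apply: contrapT => nadj; apply: noprivate.
have nadjy y : D y -> y <> x -> ~ adjacent G v y.
  by move=> Dy yx vy; apply: nadj; exists y.
exists v; split=> //.
  have [Dv|/(domD v Gv)[y Dy vy]] := pselect (D v).
    by left; apply: contrapT => vx; apply: nDv.
  right; have [<-//|yx] := pselect (y = x).
  by case: (nadjy y Dy yx).
by move=> y Dy yx; split=> [vy|]; [apply: nDv; rewrite vy | apply: nadjy].
Qed.

End MinimalDominating.

Section Support.

Variables (F : fieldType) (V : vectType F) (U W : {vspace V}) (r s : nat).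
Variables (alpha : r.-tuple V) (beta : s.-tuple V).
Hypotheses (hUW : (U + W)%VS = fullv) (hdirect : directv (U + W)).
Hypotheses (halpha : basis_of U alpha) (hbeta : basis_of W beta).

(** Directness makes the concatenated bases a basis of [U + W], here the whole space, so the
    coordinates recover [x]. *)
Lemma coefUW_sum (x : V) :
  x = \sum_i coefU alpha beta i x *: alpha`_i
      + \sum_j coefW alpha beta j x *: beta`_j.
Proof.
have /span_basis ab := cat_basis hdirect halpha hbeta.
rewrite {1}(@coord_span _ _ _ (cat_tuple alpha beta) x); last first.
  by rewrite ab hUW memvf.
rewrite big_split_ord /=; congr (_ + _); apply: eq_bigr => i _ /=.
  by rewrite nth_cat size_tuple ltn_ord.
by rewrite nth_cat size_tuple ltnNge leq_addr /= addKn.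
Qed.

Lemma sum_coefU_mem (x : V) : \sum_i coefU alpha beta i x *: alpha`_i \in U.
Proof.
apply: memv_suml => i _; apply/memvZ/(basis_mem halpha)/mem_nth.
by rewrite size_tuple.
Qed.

Lemma sum_coefW_mem (x : V) : \sum_j coefW alpha beta j x *: beta`_j \in W.
Proof.
apply: memv_suml => i _; apply/memvZ/(basis_mem hbeta)/mem_nth.
by rewrite size_tuple.
Qed.

Lemma memv_directI (v : V) : v \in U -> v \in W -> v = 0.
Proof.
move: hdirect => /directv_addP UW0 vU vW.
by apply/eqP; rewrite -memv0 -UW0 memv_cap vU.
Qed.

(** Otherwise [x] would lie in [W], hence so would [u = x - w], and [u] would be zero because [U]
    and [W] meet trivially. *)
Lemma dsg_vertex_coefU (x : V) : dsg_vertex U W x ->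
  exists i, coefU alpha beta i x != 0.
Proof.
move=> [u [w [uU wW u0 _ xE]]]; apply/existsP.
apply: contraNT u0 => /existsPn x0; apply/eqP/memv_directI => //.
rewrite -[u](addrK w) -xE rpredB // (coefUW_sum x) big1.
  by rewrite add0r sum_coefW_mem.
by move=> i _; move: (x0 i) => /negPn/eqP->; rewrite scale0r.
Qed.

Lemma dsg_vertex_coefW (x : V) : dsg_vertex U W x ->
  exists j, coefW alpha beta j x != 0.
Proof.
move=> [u [w [uU wW _ w0 xE]]]; apply/existsP.
apply: contraNT w0 => /existsPn x0; apply/eqP/memv_directI => //.
rewrite -[w](addKr u) -xE rpredD ?rpredN // (coefUW_sum x) addrC big1.
  by rewrite add0r sum_coefU_mem.
by move=> i _; move: (x0 i) => /negPn/eqP->; rewrite scale0r.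
Qed.

End Support.

Theorem theorem2p5 (F : fieldType) (V : vectType F) (U W : {vspace V})
    (alpha : (\dim U).-tuple V) (beta : (\dim W).-tuple V)
    (hUW : (U + W)%VS = fullv) (hdirect : directv (U + W))
    (hU : U <> 0%VS) (hW : W <> 0%VS) (hdim : (1 < \dim {:V})%N)
    (halpha : basis_of U alpha) (hbeta : basis_of W beta)
    (k : nat) (x : k.-tuple V) (hx : uniq x)
    (hD : minimal_dominating (direct_sum_graph U W alpha beta) [set` x]) :
  (k <= \dim U * \dim W)%N.
Proof.
pose rect z (c : 'I_(\dim U) * 'I_(\dim W)) :=
  coefU alpha beta c.1 z != 0 /\ coefW alpha beta c.2 z != 0.
have rect_vertex z : dsg_vertex U W z -> exists c, rect z c.
  move=> Gz; have [i iz] := dsg_vertex_coefU hUW hdirect halpha hbeta Gz.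
  by have [j jz] := dsg_vertex_coefW hUW hdirect halpha hbeta Gz; exists (i, j).
have private (a : 'I_k) : exists c, rect (tnth x a) c /\
    forall b, b != a -> ~ rect (tnth x b) c.
  have Da : [set` x] (tnth x a) by exact: mem_tnth.
  have [v [Gv va vD]] := minimal_dominating_private hD Da.
  (* If [v] is the vertex itself, any pair of its nonempty rectangle serves; if adjacent, the two
     indices witnessing adjacency form the pair. *)
  have [c [cv cx]] : exists c, rect v c /\ rect (tnth x a) c.
    case: va => [<-|[_ _ _ [i [iv ix]] [j [jv jx]]]]; last by exists (i, j).
    by have [c cv] := rect_vertex v Gv; exists c.
  exists c; split=> // b ba cb.
  have Db : [set` x] (tnth x b) by exact: mem_tnth.
  (* [uniq x] turns distinct indices into distinct vertices. Sharing [c] would then make [v]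
     adjacent to [tnth x b], since also [v <> tnth x b]. *)
  have [|vb] := vD _ Db; first by move/(tuple_uniqP _ hx)/eqP; apply/negP.
  apply; split=> //; first by have [[DG _] _] := hD; exact: DG Db.
    by exists c.1; case: cv; case: cb.
  by exists c.2; case: cv; case: cb.
have [c cP] := choice private.
(* If [c a = c b] with [a != b], the pair [c b] would lie in the rectangle of [tnth x a], against
   its privacy for [b]. *)
have c_inj : injective c.
  move=> a b cab; apply/eqP/negPn/negP => ab.
  by case: (cP b) => _ /(_ a ab); rewrite -cab; apply; case: (cP a).
by have := leq_card c c_inj; rewrite card_prod !card_ord.
Qed.
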